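(* Let $\Theta$ be a finite set, $\pi\in\Delta(\Theta)$ a full-support prior, $(N,\nu)$ a nest structure for $\pi$, and $\zeta,\eta>0$. Let $H_\pi:\Delta(\Theta)\to[0,+\infty]$ be the nested Shannon entropy $$H_\pi(p)=\min\Big\{\zeta D_{\mathrm{KL}}(\bar\mu\Vert\bar\nu)+\eta\sum_{i\in N}\bar\mu(i)D_{\mathrm{KL}}(\mu_i\Vert\nu_i):\ \mu\in\Delta(N\times\Theta)\text{ with marginal }p\text{ on }\Theta\Big\}.$$ Then its conjugate $H_\pi^\star(x)=\max_{p\in\Delta(\Theta)}\sum_{\theta\in\Theta}x(\theta)p(\theta)-H_\pi(p)$ is given, for every $x\in\mathbb{R}^\Theta$, by $$H_\pi^\star(x)=\zeta\log\left(\sum_{i\in N}\bar\nu(i)\Big(\sum_{\theta\in\Theta}\nu_i(\theta)e^{x(\theta)/\eta}\Big)^{\eta/\zeta}\right).$$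
   Context: A nest structure $(N,\nu)$ for $\pi$ consists of a finite set $N$ and a joint distribution $\nu\in\Delta(N\times\Theta)$ whose marginal on $N$ has full support and whose marginal on $\Theta$ is $\pi$. For $\mu\in\Delta(N\times\Theta)$, $\bar\mu\in\Delta(N)$ denotes its marginal on $N$ and $\mu_i\in\Delta(\Theta)$ the conditional distribution on $\Theta$ given $i\in N$ (terms with $\bar\mu(i)=0$ contribute $0$ to the sum); similarly $\bar\nu$, $\nu_i$. $D_{\mathrm{KL}}(\beta\Vert\alpha)=\sum_x\beta(x)\log(\beta(x)/\alpha(x))$, equal to $+\infty$ if $\beta$ is not absolutely continuous with respect to $\alpha$. *)

(* Defs.v *)
From mathcomp Require Export all_boot all_order all_algebra.
From mathcomp Require Export all_classical all_reals all_analysis.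
Set Implicit Arguments.
Unset Strict Implicit.
Unset Printing Implicit Defensive.
Import Order.TTheory GRing.Theory Num.Theory.

Local Open Scope classical_set_scope.
Local Open Scope ring_scope.

Definition simplex (R : realType) (T : finType) : set (T -> R) :=
  [set p | (forall t, 0 <= p t) /\ \sum_t p t = 1].

Definition full_support (R : realType) (T : finType) (p : T -> R) : Prop :=
  forall t, 0 < p t.

Definition marg1 (R : realType) (N Theta : finType) (mu : N * Theta -> R) :
    N -> R :=
  fun i => \sum_theta mu (i, theta).

Definition marg2 (R : realType) (N Theta : finType) (mu : N * Theta -> R) :
    Theta -> R :=
  fun theta => \sum_i mu (i, theta).

(* If marg1 mu i = 0, division by zero makes this the zero function; it is then
   only used multiplied by marg1 mu i. *)
Definition cond2 (R : realType) (N Theta : finType) (mu : N * Theta -> R)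
    (i : N) : Theta -> R :=
  fun theta => mu (i, theta) / marg1 mu i.

Definition nest_structure (R : realType) (N Theta : finType)
    (prior : Theta -> R) (nu : N * Theta -> R) : Prop :=
  [/\ simplex nu, full_support (marg1 nu) & marg2 nu = prior].

Definition abs_cont (R : realType) (T : finType) (b a : T -> R) : bool :=
  [forall t, (a t == 0) ==> (b t == 0)].

(* Since b t = 0 kills its term, the sum implements the convention
   0 * log (0 / a) = 0, including a = 0. *)
Definition KL (R : realType) (T : finType) (b a : T -> R) : \bar R :=
  if abs_cont b a then (\sum_t b t * ln (b t / a t))%:E else +oo%E.

(* In \bar R, 0 * +oo = 0, so nests with marg1 mu i = 0 contribute 0. *)
Definition nested_cost (R : realType) (N Theta : finType) (zeta eta : R)
    (nu mu : N * Theta -> R) : \bar R :=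
  (zeta%:E * KL (marg1 mu) (marg1 nu) +
   eta%:E * \sum_i ((marg1 mu i)%:E * KL (cond2 mu i) (cond2 nu i)))%E.

Definition nested_costs (R : realType) (N Theta : finType) (zeta eta : R)
    (nu : N * Theta -> R) (p : Theta -> R) : set (\bar R) :=
  [set nested_cost zeta eta nu mu | mu in
     [set mu : N * Theta -> R | simplex mu /\ marg2 mu = p]].

(* An infimum is a minimum exactly when it belongs to the set of values. *)
Definition nested_entropy (R : realType) (N Theta : finType) (zeta eta : R)
    (nu : N * Theta -> R) (p : Theta -> R) : \bar R :=
  ereal_inf (nested_costs zeta eta nu p).

Definition conjugate_values (R : realType) (Theta : finType)
    (H : (Theta -> R) -> \bar R) (x : Theta -> R) : set (\bar R) :=
  [set ((\sum_theta x theta * p theta)%:E - H p)%E | p in @simplex R Theta].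

Definition conjugate (R : realType) (Theta : finType)
    (H : (Theta -> R) -> \bar R) (x : Theta -> R) : \bar R :=
  ereal_sup (conjugate_values H x).

(* Main.v *)
(** For a simplex [a] and any [y], Gibbs' variational principle says that
    [sum b y - KL(b || a) <= ln (sum a e^y)], with equality at the tilted
    distribution [b] proportional to [a e^y].  By the chain rule for the cost,
    applying this inside each nest (with [y = x / eta]) and then across nests
    (with [y i = (eta / zeta) ln S i], [S i] the inner partition function)
    bounds [sum x p - cost mu] by the nested log-sum-exp, and the nested
    tilting attains the bound.  The minimum defining the entropy exists since
    the cost is continuous, through [y ln y], on the compact set of couplings
    absolutely continuous with respect to [nu]; it is nonnegative by the
    inequality at [x = 0]. *)
Require Import Defs.
From mathcomp Require Import ring lra.
Set Implicit Arguments.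
Unset Strict Implicit.
Unset Printing Implicit Defensive.
Import Order.TTheory GRing.Theory Num.Theory.
Import numFieldNormedType.Exports.
Local Open Scope classical_set_scope.
Local Open Scope ring_scope.

(** * Gibbs' variational principle on a finite set *)

Definition KL_real (R : realType) (T : finType) (b a : T -> R) : R :=
  \sum_t b t * ln (b t / a t).

Lemma sum_expR_gt0 (R : realType) (T : finType) (a y : T -> R) :
  simplex a -> 0 < \sum_t a t * expR (y t).
Proof.
move=> [a0 a1]; rewrite lt_neqAle sumr_ge0 ?andbT; last first.
  by move=> t _; rewrite mulr_ge0 ?expR_ge0.
apply/negP => /eqP /esym /psumr_eq0P ae0.
suff : (1 : R) = 0 by move/eqP; rewrite oner_eq0.
rewrite -a1 big1// => t _; apply/eqP.
have := ae0 (fun t _ => mulr_ge0 (a0 t) (expR_ge0 _)) t isT.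
by move/eqP; rewrite mulf_eq0 (gt_eqF (expR_gt0 _)) orbF.
Qed.

Lemma abs_contP (R : realType) (T : finType) (b a : T -> R) :
  reflect (forall t, a t = 0 -> b t = 0) (abs_cont b a).
Proof.
apply: (iffP forallP) => [h t /eqP at0|h t]; last first.
  by apply/implyP => /eqP /h ->.
by apply/eqP; move: (h t); rewrite at0.
Qed.

(** Apply [ln u <= u - 1] to each ratio of the tilted distribution to [b]; the resulting bounds are
    differences of two probability vectors, so they sum to 0. *)
Lemma gibbs_le (R : realType) (T : finType) (b a y : T -> R) :
  simplex b -> simplex a -> abs_cont b a ->
  \sum_t b t * y t - KL_real b a <= ln (\sum_t a t * expR (y t)).
Proof.
move=> [b0 b1] sa /abs_contP ba; have [a0 _] := sa.
have := sum_expR_gt0 y sa; set Z := \sum_t _ => Z0.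
rewrite -subr_le0 -[ln Z]mul1r -{1}b1 mulr_suml /KL_real -!sumrB.
have Zb : \sum_t (a t * expR (y t) / Z - b t) = 0.
  by rewrite sumrB b1 -mulr_suml divff ?gt_eqF// subrr.
rewrite -[leRHS]Zb; apply: ler_sum => t _; have := b0 t.
rewrite le_eqVlt => /predU1P[<-|bt0].
  by rewrite !mul0r !subr0 mulr_ge0 ?invr_ge0 ?(ltW Z0)// mulr_ge0 ?expR_ge0.
have at0 : 0 < a t.
  rewrite lt_neqAle a0 andbT; apply/eqP => /esym /ba bt.
  by rewrite bt ltxx in bt0.
have r0 : 0 < a t * expR (y t) / (Z * b t).
  by rewrite divr_gt0 ?mulr_gt0 ?expR_gt0.
have -> : b t * y t - b t * ln (b t / a t) - b t * ln Z =
  b t * ln (1 + (a t * expR (y t) / (Z * b t) - 1)).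
  rewrite [1 + _]addrC subrK !ln_div ?posrE ?mulr_gt0 ?expR_gt0// !lnM ?posrE ?expR_gt0//.
  by rewrite expRK; ring.
apply: (@le_trans _ _ (b t * (a t * expR (y t) / (Z * b t) - 1))).
  rewrite ler_pM2l// le_ln1Dx//; lra.
suff -> : b t * (a t * expR (y t) / (Z * b t) - 1) =
    a t * expR (y t) / Z - b t by [].
field.
by rewrite !gt_eqF.
Qed.

(** Where [a t > 0], the ratio [b t / a t] is [expR (y t) / Z], so each summand is exactly
    [b t * ln Z]. *)
Lemma gibbs_eq (R : realType) (T : finType) (a y : T -> R) :
  simplex a ->
  let Z := \sum_t a t * expR (y t) in
  let b := fun t => a t * expR (y t) / Z in
  [/\ simplex b, abs_cont b a & \sum_t b t * y t - KL_real b a = ln Z].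
Proof.
move=> sa Z b; have [a0 _] := sa; have Z0 : 0 < Z := sum_expR_gt0 y sa.
have b1 : \sum_t b t = 1 by rewrite -mulr_suml divff ?gt_eqF.
split.
- split=> // t.
  by rewrite mulr_ge0 ?invr_ge0 ?(ltW Z0)// mulr_ge0 ?expR_ge0.
- by apply/abs_contP => t at0; rewrite /b at0 !mul0r.
rewrite -[RHS]mul1r -b1 mulr_suml -sumrB; apply: eq_bigr => t _.
have := a0 t; rewrite le_eqVlt => /predU1P[at0|at0].
  by rewrite /b -at0 !mul0r subr0.
rewrite -mulrBr; congr (_ * _).
have -> : b t / a t = expR (y t) / Z by rewrite /b; field; rewrite !gt_eqF.
by rewrite ln_div ?posrE ?expR_gt0// expRK; ring.
Qed.

(** * Disintegration over nests and finiteness of the cost *)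

Section Nest.
Variables (R : realType) (N Theta : finType).
Implicit Types (mu nu : N * Theta -> R) (x : Theta -> R).

Lemma sum_marg1 mu : \sum_i marg1 mu i = \sum_u mu u.
Proof.
by rewrite (pair_bigA _ (fun i t => mu (i, t)))/=; apply: eq_bigr => -[].
Qed.

Lemma sum_marg2 mu : \sum_t marg2 mu t = \sum_u mu u.
Proof. by rewrite -sum_marg1 exchange_big. Qed.

Lemma simplex_marg1 mu : simplex mu -> simplex (marg1 mu).
Proof.
move=> [mu0 mu1]; split=> [i|]; first exact: sumr_ge0.
by rewrite sum_marg1.
Qed.

Lemma simplex_marg2 mu : simplex mu -> simplex (marg2 mu).
Proof.
move=> [mu0 mu1]; split=> [i|]; first exact: sumr_ge0.
by rewrite sum_marg2.
Qed.

Lemma simplex_cond2 mu i :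
  simplex mu -> marg1 mu i != 0 -> simplex (cond2 mu i).
Proof.
move=> smu mi0; have [mu0 _] := smu; have [m0 _] := simplex_marg1 smu.
split=> [t|]; first by rewrite divr_ge0.
by rewrite -mulr_suml divff.
Qed.

Lemma marg1_eq0 mu i t : simplex mu -> marg1 mu i = 0 -> mu (i, t) = 0.
Proof. by move=> [mu0 _] /psumr_eq0P; apply. Qed.

Lemma marg1_cond2 mu i t : simplex mu -> mu (i, t) = marg1 mu i * cond2 mu i t.
Proof.
move=> smu; have [m0|m0] := eqVneq (marg1 mu i) 0.
  by rewrite m0 mul0r marg1_eq0.
by rewrite /cond2 mulrC divfK.
Qed.

Lemma abs_cont_cond2 mu nu i : full_support (marg1 nu) -> abs_cont mu nu ->
  abs_cont (cond2 mu i) (cond2 nu i).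
Proof.
move=> fnu /abs_contP munu; apply/abs_contP => t /eqP.
rewrite mulf_eq0 invr_eq0 (gt_eqF (fnu i)) orbF => /eqP /munu mut.
by rewrite /cond2 mut mul0r.
Qed.

Lemma abs_cont_full (b a : N -> R) : full_support a -> abs_cont b a.
Proof. by move=> fa; apply/abs_contP => i ai; move: (fa i); rewrite ai ltxx. Qed.

Definition nested_cost_real (zeta eta : R) nu mu : R :=
  zeta * KL_real (marg1 mu) (marg1 nu) +
  eta * \sum_i marg1 mu i * KL_real (cond2 mu i) (cond2 nu i).

Lemma nested_cost_fin (zeta eta : R) nu mu :
  full_support (marg1 nu) -> abs_cont mu nu ->
  nested_cost zeta eta nu mu = (nested_cost_real zeta eta nu mu)%:E.
Proof.
move=> fnu munu; rewrite /nested_cost /KL abs_cont_full//.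
rewrite (eq_bigr (fun i => (marg1 mu i * KL_real (cond2 mu i) (cond2 nu i))%:E)).
  by rewrite sumEFin -!EFinM -EFinD.
by move=> i _; rewrite abs_cont_cond2.
Qed.

(** A point charged by [mu] but not by [nu] lies in a nest of positive [mu]-mass, whose conditional
    divergence is then infinite. *)
Lemma nested_cost_pinfty (zeta eta : R) nu mu :
  0 < eta -> simplex mu -> full_support (marg1 nu) -> ~~ abs_cont mu nu ->
  nested_cost zeta eta nu mu = +oo%E.
Proof.
move=> eta0 smu fnu /forallPn[[i t]]; rewrite negb_imply => /andP[nu0 mu0].
have m0 : 0 < marg1 mu i.
  rewrite lt_neqAle (simplex_marg1 smu).1 andbT eq_sym.
  by apply: contra mu0 => /eqP mi; rewrite marg1_eq0.
rewrite /nested_cost /KL abs_cont_full// -EFinM.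
have -> : (\sum_i (marg1 mu i)%:E *
    (if abs_cont (cond2 mu i) (cond2 nu i)
     then (\sum_t cond2 mu i t * ln (cond2 mu i t / cond2 nu i t))%:E
     else +oo) = +oo)%E; last by rewrite gt0_muley.
(* One infinite term suffices provided no term is [-oo], which is the side condition. *)
apply/eqP; rewrite esum_eqy => [|j _]; last first.
  case: ifP => // _; have := (simplex_marg1 smu).1 j; rewrite le_eqVlt.
  by case/predU1P => [<-|mj]; [rewrite mul0e|rewrite gt0_muley].
apply/existsP; exists i => /=; case: ifPn => [/abs_contP ac|_]; last first.
  by rewrite gt0_muley.
have : cond2 mu i t = 0 by apply: ac; rewrite /cond2 (eqP nu0) mul0r.
by move/eqP; rewrite mulf_eq0 invr_eq0 (negPf mu0) (gt_eqF m0).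
Qed.

(** * The nested log-sum-exp: upper bound and tilted coupling *)

Lemma sum_marg2_mul mu x : simplex mu ->
  \sum_t x t * marg2 mu t = \sum_i marg1 mu i * \sum_t cond2 mu i t * x t.
Proof.
move=> smu; under eq_bigr do rewrite mulr_sumr.
rewrite exchange_big; apply: eq_bigr => i _ /=; rewrite mulr_sumr.
by apply: eq_bigr => t _; rewrite (marg1_cond2 _ _ smu); ring.
Qed.

Definition nested_logit (zeta eta : R) nu x : R :=
  zeta * ln (\sum_i marg1 nu i *
    (\sum_t cond2 nu i t * expR (x t / eta)) `^ (eta / zeta)).

(** Writing the power as an exponential gives the outer sum the shape of a Gibbs partition function;
    the inner sums are positive, so the value of [powR] at 0 does not arise. *)
Lemma nested_logitE (zeta eta : R) nu x :
  simplex nu -> full_support (marg1 nu) ->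
  nested_logit zeta eta nu x =
  zeta * ln (\sum_i marg1 nu i * expR (eta / zeta *
    ln (\sum_t cond2 nu i t * expR (x t / eta)))).
Proof.
move=> snu fnu; congr (_ * ln _); apply: eq_bigr => i _; congr (_ * _).
rewrite /powR gt_eqF// (sum_expR_gt0 (fun t => x t / eta))//.
by apply: simplex_cond2; rewrite ?gt_eqF.
Qed.

(** Grouped by nest, each inner bracket is a Gibbs objective at [x / eta]. *)
Lemma conjugate_cost_split (zeta eta : R) nu mu x :
  zeta != 0 -> eta != 0 -> simplex mu ->
  \sum_t x t * marg2 mu t - nested_cost_real zeta eta nu mu =
  \sum_i marg1 mu i * (eta *
    (\sum_t cond2 mu i t * (x t / eta) - KL_real (cond2 mu i) (cond2 nu i))) -
  zeta * KL_real (marg1 mu) (marg1 nu).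
Proof.
move=> z0 e0 smu; rewrite sum_marg2_mul// opprD addrA addrAC; congr (_ - _).
rewrite mulr_sumr -sumrB; apply: eq_bigr => i _.
have -> : \sum_t cond2 mu i t * (x t / eta) = (\sum_t cond2 mu i t * x t) / eta.
  by rewrite mulr_suml; apply: eq_bigr => t _; rewrite mulrA.
by field.
Qed.

Lemma nested_logit_ge (zeta eta : R) nu mu x :
  0 < zeta -> 0 < eta -> simplex nu -> full_support (marg1 nu) ->
  simplex mu -> abs_cont mu nu ->
  \sum_t x t * marg2 mu t - nested_cost_real zeta eta nu mu <=
  nested_logit zeta eta nu x.
Proof.
move=> z0 e0 snu fnu smu munu; rewrite conjugate_cost_split ?gt_eqF// nested_logitE//.
apply: (@le_trans _ _ (zeta * (\sum_i marg1 mu i * (eta / zeta *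
    ln (\sum_t cond2 nu i t * expR (x t / eta))) -
    KL_real (marg1 mu) (marg1 nu)))); last first.
  rewrite ler_pM2l//; apply: gibbs_le; [exact: simplex_marg1|
    exact: simplex_marg1|exact: abs_cont_full].
rewrite mulrBr lerB// mulr_sumr; apply: ler_sum => i _.
(* In a massless nest [cond2 mu i] is zero, not a distribution, so this case is settled before Gibbs
   is used. *)
have [->|mi0] := eqVneq (marg1 mu i) 0; first by rewrite !mul0r mulr0.
have -> : forall m S, zeta * (m * (eta / zeta * S)) = m * (eta * S).
  by move=> m S; field; rewrite gt_eqF.
rewrite ler_wpM2l ?(simplex_marg1 smu).1// ler_pM2l//; apply: gibbs_le.
- exact: simplex_cond2.
- by apply: simplex_cond2; rewrite ?gt_eqF.
- exact: abs_cont_cond2.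
Qed.

Lemma nested_logit_attained (zeta eta : R) nu x :
  0 < zeta -> 0 < eta -> simplex nu -> full_support (marg1 nu) ->
  exists mu, [/\ simplex mu, abs_cont mu nu &
  \sum_t x t * marg2 mu t - nested_cost_real zeta eta nu mu =
  nested_logit zeta eta nu x].
Proof.
move=> z0 e0 snu fnu.
have snui i : simplex (cond2 nu i) by apply: simplex_cond2; rewrite ?gt_eqF.
pose S i := \sum_t cond2 nu i t * expR (x t / eta).
(* [b i] tilts inside nest [i]; [m] below tilts across nests by the inner values [y]. *)
pose b i t := cond2 nu i t * expR (x t / eta) / S i.
pose y i := eta / zeta * ln (S i).
pose W := \sum_i marg1 nu i * expR (y i).
pose m i := marg1 nu i * expR (y i) / W.
have bP i : [/\ simplex (b i), abs_cont (b i) (cond2 nu i) &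
    \sum_t b i t * (x t / eta) - KL_real (b i) (cond2 nu i) = ln (S i)].
  exact: (gibbs_eq (fun t => x t / eta) (snui i)).
have [sm _ mE] : [/\ simplex m, abs_cont m (marg1 nu) &
    \sum_i m i * y i - KL_real m (marg1 nu) = ln W].
  exact: (gibbs_eq y (simplex_marg1 snu)).
have W0 : 0 < W := sum_expR_gt0 y (simplex_marg1 snu).
(* Positive mass in every nest lets [b i] be recovered as the conditional of [mu]. *)
have m0 i : 0 < m i by rewrite divr_gt0// mulr_gt0 ?expR_gt0.
pose mu (u : N * Theta) := m u.1 * b u.1 u.2.
have mu1 : marg1 mu = m.
  apply/funext => i; rewrite /marg1 /mu/= -mulr_sumr.
  by case: (bP i) => -[_ ->]; rewrite mulr1.
have mu2 i : cond2 mu i = b i.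
  by apply/funext => t; rewrite /cond2 mu1 /mu/= mulrC mulKf ?gt_eqF.
have smu : simplex mu.
  split=> [[i t]|]; first by rewrite mulr_ge0 ?(ltW (m0 _))//; case: (bP i) => -[].
  by rewrite -sum_marg1 mu1 sm.2.
exists mu; split=> //.
  apply/abs_contP => -[i t] nu0; rewrite /mu/= /b /cond2 nu0; ring.
rewrite conjugate_cost_split ?gt_eqF// nested_logitE// -[RHS]/(zeta * ln W) -mE mu1 mulrBr.
congr (_ - _); rewrite mulr_sumr; apply: eq_bigr => i _.
by rewrite mu2; case: (bP i) => _ _ ->; rewrite /y; field; rewrite gt_eqF.
Qed.
End Nest.

(** * Continuity of [x * ln x] and of finite sums *)

Lemma continuous_xlnx (R : realType) : continuous (fun x : R => x * ln x).
Proof.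
move=> x; have [x0|x0] := ltP 0 x.
  by apply: continuousM; [exact: cvg_id|exact: continuous_ln].
(* With [s] the square root of [y], this comes from [ln s^-1 < s^-1] and [ln y = 2 * ln s]. *)
have bnd (y : R) : y < 1 -> `|y * ln y| <= 2 * Num.sqrt y.
  move=> y1; have [y0|y0] := ltP 0 y; last first.
    by rewrite ln0// mulr0 normr0 mulr_ge0 ?sqrtr_ge0.
  pose s := Num.sqrt y; have s0 : 0 < s by rewrite sqrtr_gt0.
  have ys : y = s ^+ 2 by rewrite sqr_sqrtr ?ltW.
  have := ln_sublinear (_ : 0 < s^-1); rewrite invr_gt0 => /(_ s0).
  rewrite lnV ?posrE// => lns.
  have lns0 : ln y <= 0 by apply: ln_le0; exact: ltW.
  rewrite normrM (ger0_norm (ltW y0)) ler0_norm// -/s ys lnXn// mulr2n opprD.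
  apply: (@le_trans _ _ (s ^+ 2 * (s^-1 + s^-1))).
    by rewrite ler_pM2l ?exprn_gt0// lerD ?ltW.
  suff -> : s ^+ 2 * (s^-1 + s^-1) = 2 * s by [].
  by field; rewrite gt_eqF.
rewrite /continuous_at ln0// mulr0.
(* [Num.sqrt] vanishes on nonpositive reals, so the squeeze works at every [x <= 0]. *)
have s0 : 2 * Num.sqrt y @[y --> x] --> 0.
  rewrite -[X in _ --> X](mulr0 2) -(ler0_sqrtr x0).
  by apply: cvgM; [exact: cvg_cst|exact: sqrt_continuous].
have near1 : \forall y \near x, `|y * ln y| <= 2 * Num.sqrt y.
  near=> y; apply: bnd; near: y.
  by apply: (cvgr_lt x) => //; exact: le_lt_trans x0 ltr01.
apply: (@squeeze_cvgr _ _ _ _ (fun y => - (2 * Num.sqrt y))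
  (fun y => 2 * Num.sqrt y)) => //.
  by near do rewrite -ler_norml.
by rewrite -[X in _ --> X]oppr0; exact: cvgN.
Unshelve. all: by end_near. Qed.

Lemma continuous_sumr (R : realType) (T : topologicalType) (I : finType)
    (f : I -> T -> R) :
  (forall i, continuous (f i)) -> continuous (fun z => \sum_i f i z).
Proof.
move=> cf; rewrite -fct_sumE; apply: (big_ind (fun g : T -> R => continuous g)).
- by move=> z; exact: cvg_cst.
- by move=> g h cg ch z; exact: (continuousD (cg z) (ch z)).
- by move=> i _; exact: cf.
Qed.

(** * Existence of a cost-minimising coupling *)

Section Minimum.
Variables (R : realType) (N Theta : finType) (zeta eta : R).
Variables (nu : N * Theta -> R) (p : Theta -> R).
Hypotheses (snu : simplex nu) (fnu : full_support (marg1 nu)).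

Let xlnx (y : R) := y * ln y.

(* The real cost without its quotients: [ln 0 = 0] makes [xlnx] continuous on
   all of [R], hence this function continuous even where a nest has mass 0. *)
Definition nested_cost_cont (mu : {ptws N * Theta -> R}) : R :=
  zeta * \sum_i (xlnx (marg1 mu i) - marg1 mu i * ln (marg1 nu i)) +
  eta * \sum_i (\sum_t (xlnx (mu (i, t)) - mu (i, t) * ln (cond2 nu i t)) -
                xlnx (marg1 mu i)).

Lemma nested_cost_contE (mu : N * Theta -> R) : simplex mu -> abs_cont mu nu ->
  nested_cost_real zeta eta nu mu = nested_cost_cont mu.
Proof.
move=> smu /abs_contP munu; have [m0 _] := simplex_marg1 smu.
(* At [a = 0] both sides vanish, since then [b = 0]: this is where absolute continuity enters. *)
have xlnxE (b a : R) : 0 <= b -> (a = 0 -> b = 0) -> 0 <= a ->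
    b * ln (b / a) = xlnx b - b * ln a.
  rewrite /xlnx le_eqVlt => /predU1P[<-|b0] ab; first by rewrite !mul0r subrr.
  rewrite le_eqVlt => /predU1P[a0|a0]; last by rewrite ln_div ?posrE// mulrBr.
  by move: b0; rewrite ab ?ltxx.
congr (_ * _ + _ * _); apply: eq_bigr => i _.
  by apply: xlnxE; rewrite ?(ltW (fnu i))// => ni; move: (fnu i); rewrite ni ltxx.
have [mi0|mi0] := eqVneq (marg1 mu i) 0.
  rewrite mi0 mul0r big1 /xlnx ?mul0r ?subr0// => t _.
  by rewrite marg1_eq0// !mul0r subr0.
have mi : 0 < marg1 mu i by rewrite lt_neqAle m0 eq_sym mi0.
have -> : xlnx (marg1 mu i) = \sum_t mu (i, t) * ln (marg1 mu i).
  by rewrite -mulr_suml.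
rewrite /KL_real mulr_sumr -sumrB; apply: eq_bigr => t _.
rewrite xlnxE; last 3 first.
- by rewrite divr_ge0 ?smu.1.
- move=> /eqP; rewrite mulf_eq0 invr_eq0 (gt_eqF (fnu i)) orbF => /eqP /munu.
  by rewrite /cond2 => ->; rewrite mul0r.
- by rewrite divr_ge0 ?snu.1 ?ltW.
rewrite mulrBr mulrA -marg1_cond2// /xlnx mulrA -marg1_cond2//.
have := smu.1 (i, t); rewrite le_eqVlt => /predU1P[<-|mit]; first by ring.
by rewrite {1}/cond2 ln_div ?posrE//; ring.
Qed.

Lemma continuous_nested_cost_cont : continuous nested_cost_cont.
Proof.
have cpr u : continuous (fun mu : {ptws N * Theta -> R} => mu u).
  exact: (@proj_continuous _ (fun=> R)).
have cx (g : {ptws N * Theta -> R} -> R) : continuous g ->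
    continuous (xlnx \o g).
  by move=> cg z; apply: continuous_comp; [exact: cg|exact: continuous_xlnx].
have cm i : continuous (fun mu : {ptws N * Theta -> R} => marg1 mu i).
  by apply: continuous_sumr => t; exact: cpr.
have cB (g h : {ptws N * Theta -> R} -> R) : continuous g -> continuous h ->
    continuous (fun mu => g mu - h mu).
  by move=> cg ch z; exact: (cvgB (cg z) (ch z)).
have cM (g : {ptws N * Theta -> R} -> R) (c : R) : continuous g ->
    continuous (fun mu => g mu * c).
  by move=> cg z; exact: (cvgM (cg z) (cvg_cst c)).
have cs1 := continuous_sumr (fun i =>
  cB _ _ (cx _ (cm i)) (cM _ (ln (marg1 nu i)) (cm i))).
have cs2 := continuous_sumr (fun i => cB _ _ (continuous_sumr (fun t =>
  cB _ _ (cx _ (cpr (i, t))) (cM _ (ln (cond2 nu i t)) (cpr (i, t)))))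
  (cx _ (cm i))).
move=> z.
exact: (cvgD (cvgM (cvg_cst zeta) (cs1 z)) (cvgM (cvg_cst eta) (cs2 z))).
Qed.

Definition feasible : set {ptws N * Theta -> R} :=
  [set mu | [/\ simplex mu, abs_cont mu nu & marg2 mu = p]].

Lemma compact_feasible : simplex p -> compact feasible.
Proof.
move=> sp.
(* The box has side [[0, 1]], collapsed to [{0}] where [nu] vanishes, which encodes absolute
   continuity; total mass 1 follows from the marginal [p]. *)
have -> : feasible =
    [set mu | forall u, `[0, (nu u != 0)%:R]%classic (mu u)] `&`
    [set mu | forall t, marg2 mu t = p t].
  apply/seteqP; split => [mu [[mu0 mu1] /abs_contP munu mu2]|
                          mu [muI /funext mu2]].
    split=> [u /=|t]; last by rewrite mu2.
    rewrite in_itv/= mu0/=; have [/munu ->//|_] := eqVneq (nu u) 0.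
    by rewrite -mu1 (bigD1 u)//= lerDl sumr_ge0.
  have mu0 u : 0 <= mu u by have := muI u; rewrite /= in_itv/= => /andP[].
  split=> //.
    by split=> //; rewrite -sum_marg2 mu2 sp.2.
  apply/abs_contP => u nu0; have := muI u; rewrite /= nu0 eqxx in_itv/=.
  by rewrite -eq_le => /eqP.
apply: compact_closedI.
  apply: (@tychonoff _ (fun=> R) (fun u => `[0, (nu u != 0)%:R]%classic)) => u.
  exact: segment_compact.
have -> : [set mu : {ptws N * Theta -> R} | forall t, marg2 mu t = p t] =
    \bigcap_t [set mu | marg2 mu t = p t].
  by apply/seteqP; split => mu h t; [move=> _; exact: h|exact: h t I].
apply: closed_bigI => t _.
apply: (@preimage_closed _ _ (fun mu : {ptws N * Theta -> R} => marg2 mu t)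
  [set y | y = p t]); last exact: closed_eq.
move=> mu _; apply: continuous_sumr => i; exact: (@proj_continuous _ (fun=> R)).
Qed.

Lemma feasible_nonempty :
  simplex p -> full_support (marg2 nu) -> feasible !=set0.
Proof.
move=> sp fp.
(* Keep the conditional law of the nest given [theta] under [nu] and replace the marginal by [p]. *)
pose mu (u : N * Theta) := p u.2 * nu u / marg2 nu u.2.
have mu2 : marg2 mu = p.
  apply/funext => t; rewrite /marg2 /mu/= -mulr_suml -mulr_sumr.
  by rewrite mulfK// gt_eqF//; exact: fp.
exists mu; split=> //; last by apply/abs_contP => u nu0; rewrite /mu nu0; ring.
split=> [u|]; first by rewrite divr_ge0 ?mulr_ge0 ?sp.1 ?snu.1 ?ltW.
by rewrite -sum_marg2 mu2 sp.2.
Qed.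

(** The extreme value theorem gives a minimiser over [feasible]; all other couplings of [p] cost
    [+oo]. *)
Lemma nested_entropy_attained : 0 < eta -> simplex p -> full_support (marg2 nu) ->
  exists mu, [/\ simplex mu, abs_cont mu nu, marg2 mu = p &
    nested_entropy zeta eta nu p = (nested_cost_real zeta eta nu mu)%:E].
Proof.
move=> e0 sp fp.
have [mu /set_mem[smu munu mu2] mumin] :=
  compact_EVT_min (feasible_nonempty sp fp) (compact_feasible sp)
    (continuous_subspaceT continuous_nested_cost_cont).
exists mu; split=> //; apply/eqP; rewrite eq_le; apply/andP; split.
  by apply: ereal_inf_lbound; exists mu => //; exact: nested_cost_fin.
apply: le_ereal_inf_tmp => _ [mu' [smu' mu2'] <-].
have [munu'|munu'] := boolP (abs_cont mu' nu); last first.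
  by rewrite nested_cost_pinfty// leey.
by rewrite nested_cost_fin// lee_fin !nested_cost_contE// mumin//; exact/mem_set.
Qed.

End Minimum.

Theorem proposition13 (R : realType) (Theta N : finType)
    (prior : Theta -> R) (nu : N * Theta -> R) (zeta eta : R)
    (hprior : simplex prior) (hfull : full_support prior)
    (hnu : nest_structure prior nu) (hzeta : 0 < zeta) (heta : 0 < eta) :
  let H := nested_entropy zeta eta nu in
  (* H is well defined: a minimum, with values in [0, +oo] *)
  (forall p : Theta -> R, simplex p ->
     nested_costs zeta eta nu p (H p) /\ (0 <= H p)%E) /\
  (* the conjugate is a maximum, with the given value *)
  (forall x : Theta -> R,
     conjugate_values H x (conjugate H x) /\
     conjugate H x =
       (zeta * ln (\sum_i marg1 nu i *
          (\sum_theta cond2 nu i theta * expR (x theta / eta))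
            `^ (eta / zeta)))%:E).
Proof.
move=> H; have [snu fnu mnu] := hnu.
have Hatt p : simplex p -> exists mu, [/\ simplex mu, abs_cont mu nu,
    marg2 mu = p & H p = (nested_cost_real zeta eta nu mu)%:E].
  by move=> sp; apply: nested_entropy_attained; rewrite ?mnu.
split=> [p sp|x].
  have [mu [smu munu mu2 ->]] := Hatt _ sp; split.
    by exists mu => //; exact: nested_cost_fin.
  rewrite lee_fin -oppr_le0.
  (* At [x = 0] all partition functions equal 1, so the upper bound reads [- cost <= 0]. *)
  have logit0 : nested_logit zeta eta nu (fun=> 0) = 0.
    rewrite nested_logitE// (eq_bigr (marg1 nu)) => [|i _]; last first.
      rewrite (eq_bigr (cond2 nu i)) => [|t _]; last by rewrite mul0r expR0 mulr1.
      rewrite (simplex_cond2 snu _).2 ?gt_eqF//.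
      by rewrite ln1 mulr0 expR0 mulr1.
    by rewrite (simplex_marg1 snu).2 ln1 mulr0.
  have := nested_logit_ge (fun=> 0) hzeta heta snu fnu smu munu.
  by rewrite logit0 big1 ?sub0r// => t _; rewrite mul0r.
rewrite -/(nested_logit zeta eta nu x).
have [mu [smu munu muE]] := nested_logit_attained x hzeta heta snu fnu.
have ub : ubound (conjugate_values H x) (nested_logit zeta eta nu x)%:E.
  move=> _ [p sp <-]; have [mu' [smu' munu' <- ->]] := Hatt _ sp.
  by rewrite -EFinB lee_fin nested_logit_ge.
(* The cost of the tilted [mu] only bounds the entropy of its marginal from above; [ub] supplies the
   reverse inequality. *)
have att : conjugate_values H x (nested_logit zeta eta nu x)%:E.
  have sp := simplex_marg2 smu; exists (marg2 mu) => //.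
  apply/eqP; rewrite eq_le ub/=; last by exists (marg2 mu).
  rewrite -muE EFinB leeB// -nested_cost_fin//.
  by apply: ereal_inf_lbound; exists mu.
suff -> : conjugate H x = (nested_logit zeta eta nu x)%:E by [].
apply/eqP; rewrite eq_le; apply/andP; split; first exact: ge_ereal_sup.
exact: ereal_sup_ubound.
Qed.
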